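(* Let $U(x)=\sum_{n\ge2}d_{21\text{-}3}(n;y)x^n$, where $d_{21\text{-}3}(n;y)=\sum_{\pi\in\mathcal{D}_{21\text{-}3}(n)}y^{\mu(\pi)}$. Then, as formal power series in $x$, $$U(x)=x^2y\sum_{j\ge0}\frac{x^j\prod_{i=1}^j(1-ix+xy)}{\prod_{i=0}^j\big(1-(2i+1)x+i(i+1)x^2-x^2y\big)}.$$
   Context: Every permutation $\pi$ of $[n]=\{1,\dots,n\}$ is written in standard cycle form: each cycle is written starting with its smallest element, and the cycles are ordered from left to right by increasing first elements. The flattened form $\mathrm{flat}(\pi)$ is the word (in one-line notation) obtained by erasing the parentheses of the standard cycle form; e.g. $(135)(26)(478)$ has flattened form $13526478$. A derangement is a permutation with no fixed points; $\mathcal{D}(n)$ is the set of derangements of $[n]$, and $\mu(\pi)$ denotes the number of cycles of $\pi$. A word $w=w_1\cdots w_n$ of distinct integers contains the vincular pattern $21\text{-}3$ if there are indices $i$ and $k>i+1$ with $w_{i+1}<w_i<w_k$, and avoids it otherwise. $\mathcal{D}_{21\text{-}3}(n)$ is the set of $\pi\in\mathcal{D}(n)$ such that $\mathrm{flat}(\pi)$ avoids $21\text{-}3$. *)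

(* Defs.v *)
From mathcomp Require Import all_boot all_order all_algebra fingroup perm.

Set Implicit Arguments.
Unset Strict Implicit.
Unset Printing Implicit Defensive.

Import GRing.Theory.

Section StandardCycleForm.

Variable n : nat.
Implicit Types s : {perm 'I_n}.

Definition cycle_min s : pred 'I_n :=
  fun m => [forall x in porbit s m, m <= x].

(* [enum 'I_n] is increasing, and [orbit s m] is [:: m; s m; s (s m); ...]. *)
Definition standard_cycle_form s : seq (seq 'I_n) :=
  [seq orbit s m | m <- enum 'I_n & cycle_min s m].

(* The element [i : 'I_n] stands for the letter [i.+1] of {1, ..., n}. *)
Definition flat s : seq nat :=
  [seq (nat_of_ord i).+1 | i <- flatten (standard_cycle_form s)].

Definition derangement s : bool := [forall i, s i != i].

Definition mu s : nat := #|porbits s|.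

End StandardCycleForm.

Definition contains_21_3 (w : seq nat) : bool :=
  [exists i : 'I_(size w), exists k : 'I_(size w),
     (i.+1 < k) && (nth 0 w i.+1 < nth 0 w i < nth 0 w k)].

Definition D_21_3 (n : nat) : {set {perm 'I_n}} :=
  [set s | derangement s & ~~ contains_21_3 (flat s)].

Local Open Scope ring_scope.

(* The variable ['X] of [{poly int}] is y. *)
Definition d_21_3 (n : nat) : {poly int} :=
  \sum_(s in D_21_3 n) 'X ^+ mu s.

(* A formal power series in x is its sequence of coefficients. *)
Definition fps (R : Type) : Type := nat -> R.

Section FormalPowerSeries.

Variable R : comUnitRingType.
Implicit Types a b : fps R.

Definition fps_of_poly (p : {poly R}) : fps R := fun n => p`_n.

Definition fps_mul a b : fps R := fun n => \sum_(i < n.+1) a i * b (n - i)%N.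

(* The first n.+1 coefficients of the inverse, for a with [a 0] a unit. *)
Fixpoint fps_inv_seq a (n : nat) : seq R :=
  if n is m.+1 then
    let b := fps_inv_seq a m in
    rcons b (- (a 0%N)^-1 * \sum_(i < m.+1) a (m.+1 - i)%N * b`_i)
  else [:: (a 0%N)^-1].

Definition fps_inv a : fps R := fun n => (fps_inv_seq a n)`_n.

Definition fps_div a b : fps R := fps_mul a (fps_inv b).

(* Convergence of the partial sums for the x-adic topology, [R] discrete. *)
Definition fps_has_sum (F : nat -> fps R) (S : fps R) : Prop :=
  forall n, exists N, forall M, (N <= M)%N -> \sum_(j < M) F j n = S n.

Lemma size_fps_inv_seq a n : size (fps_inv_seq a n) = n.+1.
Proof. by elim: n => //= n IHn; rewrite size_rcons IHn. Qed.

Lemma nth_fps_inv_seq a n i : (i <= n)%N -> (fps_inv_seq a n)`_i = fps_inv a i.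
Proof.
elim: n => [|n IHn]; first by rewrite leqn0 => /eqP ->.
rewrite leq_eqVlt => /predU1P[-> //|lt_in].
by rewrite /= nth_rcons size_fps_inv_seq lt_in IHn.
Qed.

Lemma fps_mulV a : a 0%N \is a GRing.unit ->
  fps_mul a (fps_inv a) =1 fps_of_poly 1.
Proof.
move=> Ua [|n]; first by rewrite /fps_mul big_ord1 /fps_of_poly coef1 /= divrr.
rewrite /fps_mul /fps_of_poly coef1 big_ord_recl subn0 /=.
rewrite {1}/fps_inv /= nth_rcons size_fps_inv_seq ltnn eqxx.
rewrite mulrA mulrN divrr // mulN1r.
apply/eqP; rewrite addrC subr_eq0; apply/eqP.
rewrite (reindex_inj rev_ord_inj) /=; apply: eq_bigr => i _.
rewrite /bump /= add1n !subSS subKn ?leq_ord // nth_fps_inv_seq ?leq_ord //.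
by rewrite subSn ?leq_ord.
Qed.

End FormalPowerSeries.

Definition U : fps {poly int} :=
  fun n => if (2 <= n)%N then d_21_3 n else 0.

(* In [{poly {poly int}}], ['X] is x and ['X%:P] is y. *)
Definition x_ : {poly {poly int}} := 'X.
Definition y_ : {poly {poly int}} := 'X%:P.

Definition U_num (j : nat) : {poly {poly int}} :=
  x_ ^+ j * \prod_(1 <= i < j.+1) (1 - i%:R * x_ + x_ * y_).

Definition U_den (j : nat) : {poly {poly int}} :=
  \prod_(0 <= i < j.+1)
    (1 - (2 * i + 1)%:R * x_ + (i * (i + 1))%:R * x_ ^+ 2 - x_ ^+ 2 * y_).

Lemma coef0_U_den j : (U_den j)`_0 = 1.
Proof.
rewrite -horner_coef0 /U_den horner_prod big1 // => i _.
by rewrite /x_ /y_ !hornerE /= ?expr0n /= !(mulr0, mul0r, subr0, addr0).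
Qed.

(* Main.v *)
Require Import Defs.
From HB Require Import structures.
From mathcomp Require Import all_boot all_order all_algebra fingroup perm.
From mathcomp Require Import boolp zify ring.

(** A word avoids 21-3 iff each of its descent tops exceeds every later letter. In
    the flattened form of a derangement, the first letters of the cycles are smaller
    than all later letters, no two of them are adjacent and the last letter is not
    one of them. Build such marked words by inserting the letters n, n-1, ..., 1:
    each new letter is smaller than all the others, so it may be put in front, at
    the end, or just after a descent top, and declaring it to be the first letter of
    a cycle forbids all later insertions to its right. Hence the number of insertion
    positions in front of the first cycle, together with whether the place just
    before that cycle is one of them, evolves by a transfer operator. Its generating
    functions satisfy
      (1 - a x) P_a = x P_(a-1), (1 - a x) A_a = x y T_a, (1 - a x) B_a = x A_(a-1)
    with T_a the sum of the P_c + A_c + B_c for c > a, and U = A_0 = x y T_0.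
    Eliminating P, A and B, the series V_i = T_i prod_(0 < c < i) (1 - c x) satisfies
      ((1 - i x) (1 - (i+1) x) - x^2 y) V_i = (1 - (i+1) x + x y) V_(i+1) + x^(i+1),
    and iterating this relation from V_0 = T_0 gives the sum. *)

Set Implicit Arguments.
Unset Strict Implicit.
Unset Printing Implicit Defensive.

Import GRing.Theory.

(** * Marked words and insertion of a smallest letter *)

Fixpoint avoids (w : seq nat) : bool :=
  if w is a :: w' then
    ((head 0 w' < a) ==> all (ltn^~ a) w') && avoids w'
  else true.

(* A letter smaller than all of [w] can be inserted at position [p] of an avoiding
   word [w]. As letters are positive, the default value [0] makes the position
   after the last letter allowed. *)
Definition allowed (w : seq nat) (p : nat) : bool :=
  (p == 0) || (nth 0 w p < nth 0 w p.-1).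

(** A smallest letter can only play the 1 of a pattern, and the letter before it becomes a descent
    top. In an avoiding word that letter exceeds all of [v] exactly when it was a descent top
    already or [v] is empty. *)
Lemma avoids_insert m u v : all (ltn m) (u ++ v) ->
  avoids (u ++ m :: v) = avoids (u ++ v) && allowed (u ++ v) (size u).
Proof.
elim: u => [|a [|b u] IHu] /=.
- case: v => [|b v] /= => [_|/andP[lt_mb _]]; first by rewrite implybT.
  by rewrite ltnNge (ltnW lt_mb) andbT.
- case/andP=> lt_ma gtm; rewrite /= in IHu; rewrite {}IHu // lt_ma /=.
  rewrite {}/allowed /= andbT; case: v gtm => [|b v] _ /=.
    by rewrite (leq_ltn_trans _ lt_ma).
  by case: ltnP => //=; rewrite ?andbT // andbF.
case/andP=> lt_ma gtm; have {}IHu := IHu gtm; rewrite /= in IHu.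
rewrite IHu all_cat /= lt_ma /= -all_cat -!andbA; congr (_ && _).
Qed.

Lemma avoidsP w : uniq w ->
  reflect (forall i k, i.+1 < k -> k < size w ->
             ~~ (nth 0 w i.+1 < nth 0 w i < nth 0 w k))
          (avoids w).
Proof.
elim: w => [|a w IHw] /=; first by constructor.
case/andP=> aw Uw; apply: (iffP andP) => [[ha /(IHw Uw) IH] [|i] [|k] // lt_ik lt_kw|H].
- rewrite /= nth0; apply/negP=> /andP[/(implyP ha)/allP/(_ (nth 0 w k))].
  by rewrite mem_nth // => /(_ isT); lia.
- exact: IH.
split; last by apply/(IHw Uw) => i k lt_ik lt_kw; exact: (H i.+1 k.+1).
apply/implyP=> lt_ha; apply/(all_nthP 0) => k lt_kw.
case: k lt_kw => [|k] lt_kw; first by rewrite nth0.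
(* [H] only gives [<=]; distinctness of the letters excludes equality. *)
have := H 0 k.+2 isT lt_kw; rewrite /= nth0 lt_ha /= -leqNgt leq_eqVlt.
by case/predU1P=> [E|//]; rewrite -E mem_nth in aw.
Qed.

Lemma contains_avoids w : uniq w -> ~~ contains_21_3 w = avoids w.
Proof.
move=> Uw; apply/idP/(avoidsP Uw).
  move=> /existsPn H i k lt_ik lt_kw.
  have lt_iw : i < size w by lia.
  have /existsPn/(_ (Ordinal lt_kw)) := H (Ordinal lt_iw).
  by rewrite /= lt_ik.
move=> H; apply/existsPn => i; apply/existsPn => k; rewrite negb_and.
by case: ltnP => //= lt_ik; apply: H.
Qed.

(* A flattened form restricted to its large letters: [o.2] lists the cycles whose
   first element is among them, and [o.1] is the part of the word that precedes
   the first of these cycles. *)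
Local Notation partial := (seq nat * seq (seq nat))%type.

Definition word (o : partial) : seq nat := o.1 ++ flatten o.2.

(** A letter that starts a cycle takes the rest of [o.1] as the remainder of that cycle; any other
    letter joins a cycle started later by a smaller letter. *)
Definition insert (m : nat) (o : partial) (c : nat * bool) : partial :=
  if c.2 then (take c.1 o.1, (m :: drop c.1 o.1) :: o.2)
  else (take c.1 o.1 ++ m :: drop c.1 o.1, o.2).

(* The empty tail excluded in the second part would make a fixed point. *)
Definition choices (o : partial) : seq (nat * bool) :=
  [seq (p, false) | p <- iota 0 (size o.1).+1 & allowed (word o) p]
  ++ [seq (p, true) | p <- iota 0 (size o.1) & allowed (word o) p].

Fixpoint partials (m k : nat) : seq partial :=
  if k is k'.+1 then [seq insert m o c | o <- partials m.+1 k', c <- choices o]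
  else [:: ([::], [::])].

(** Comparing each head with its own cycle and with all later ones makes it the minimum of its cycle
    and orders the cycles at once. The length condition excludes fixed points. *)
Fixpoint cycles_ok (cs : seq (seq nat)) : bool :=
  if cs is c :: cs' then
    [&& 1 < size c, all (leq (head 0 c)) (c ++ flatten cs') & cycles_ok cs']
  else true.

Definition valid (m k : nat) (o : partial) : bool :=
  [&& perm_eq (word o) (iota m k), avoids (word o) & cycles_ok o.2].

Lemma mem_choices o p b :
  ((p, b) \in choices o) = (p < size o.1 + ~~ b) && allowed (word o) p.
Proof.
rewrite mem_cat; case: b.
  have -> : ((p, true) \in [seq (q, false) | q <- iota 0 (size o.1).+1
                                            & allowed (word o) q]) = false.
    by apply/mapP=> -[].
  rewrite mem_map => [|x y [->]] //.
  by rewrite orFb mem_filter mem_iota add0n addn0 andbC.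
rewrite orbC; have -> : ((p, false) \in [seq (q, true) | q <- iota 0 (size o.1)
                                            & allowed (word o) q]) = false.
  by apply/mapP=> -[].
rewrite mem_map => [|x y [->]] //.
by rewrite orFb mem_filter mem_iota add0n addn1 andbC.
Qed.

Lemma choices_uniq o : uniq (choices o).
Proof.
rewrite cat_uniq !map_inj_uniq ?filter_uniq ?iota_uniq // ?andbT; try by move=> x y [].
by apply/hasPn => _ /mapP[p _ ->]; apply/negP => /mapP[].
Qed.

Lemma word_insert m o p b : p <= size o.1 ->
  word (insert m o (p, b)) = take p (word o) ++ m :: drop p (word o).
Proof.
move=> le_p; rewrite /word /insert /= take_cat drop_cat.
case: b => /=; move: le_p; rewrite leq_eqVlt => /predU1P[->|lt_p];
  by rewrite ?lt_p ?ltnn ?subnn ?take0 ?drop0 ?take_size ?drop_size ?cats0 -?catA.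
Qed.

Lemma perm_word_insert m o p b : p <= size o.1 ->
  perm_eq (word (insert m o (p, b))) (m :: word o).
Proof.
move=> le_p; rewrite word_insert // -cat1s perm_catCA /= perm_cons.
by rewrite cat_take_drop.
Qed.

Lemma valid_gt m k o : valid m.+1 k o -> all (ltn m) (word o).
Proof.
case/and3P=> ow _ _; rewrite (perm_all _ ow); apply/allP => x.
by rewrite mem_iota => /andP[].
Qed.

Lemma gt_notin m o : all (ltn m) (word o) -> m \notin o.1.
Proof.
move=> gtm; apply/negP => mo; have /(allP gtm) : m \in word o by rewrite mem_cat mo.
by rewrite /= ltnn.
Qed.

Lemma valid_insert m k o c :
  valid m.+1 k o -> c \in choices o -> valid m k.+1 (insert m o c).
Proof.
move=> Vo; have gtm := valid_gt Vo; case/and3P: Vo => ow av ok.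
case: c => p b; rewrite mem_choices => /andP[lt_p al].
have le_p : p <= size o.1 by move: lt_p; case: b => /=; lia.
apply/and3P; split.
- by rewrite (permPl (perm_word_insert _ _ le_p)) /= perm_cons.
- rewrite word_insert // avoids_insert cat_take_drop // av size_takel //.
  by rewrite size_cat; apply: leq_trans le_p (leq_addr _ _).
case: b lt_p => //=; rewrite addn0 => lt_p.
rewrite ok leqnn size_drop ltnS subn_gt0 lt_p /= andbT.
apply/allP => x x_in; apply/ltnW; apply: (allP gtm).
rewrite /word mem_cat; move: x_in; rewrite mem_cat.
by case/orP=> [/mem_drop->//|->]; exact: orbT.
Qed.

(** Inverse of [insert m]: a smallest letter outside [o.1] has to head the first cycle. *)
Definition removal (m : nat) (o : partial) : partial * (nat * bool) :=
  if m \in o.1 then ((rem m o.1, o.2), (index m o.1, false))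
  else ((o.1 ++ behead (head [::] o.2), behead o.2), (size o.1, true)).

Lemma insertK m o p b : m \notin o.1 -> p <= size o.1 ->
  removal m (insert m o (p, b)) = (o, (p, b)).
Proof.
case: o => u cs /= mu le_p; rewrite /removal /insert /=.
have mt : m \notin take p u by apply: contra mu => /mem_take.
case: b => /=; first by rewrite (negbTE mt) cat_take_drop size_takel.
rewrite mem_cat mem_head orbT; congr (_, _, (_, _)).
  rewrite remE index_cat (negbTE mt) /= eqxx addn0 take_size_cat //.
  by rewrite drop_cat ltnNge leqnSn subSnn /= drop0 cat_take_drop.
by rewrite index_cat (negbTE mt) /= eqxx addn0 size_takel.
Qed.


Lemma removalK m k o : 0 < m -> valid m k.+1 o ->
  [/\ valid m.+1 k (removal m o).1, (removal m o).2 \in choices (removal m o).1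
    & insert m (removal m o).1 (removal m o).2 = o].
Proof.
case: o => u cs m0 Vo; have mw : m \in u ++ flatten cs.
  by case/and3P: Vo => /perm_mem-> _ _; rewrite mem_iota leqnn -addSnnS leq_addr.
(* Any preimage under [insert] will do: [avoids_insert] gives its avoidance and the allowed
   position, and [insertK] identifies it with the removal. *)
suff [o' [p [b [le_p lt_p Eo ok]]]] : exists o' p b,
  [/\ p <= size o'.1, p < size o'.1 + ~~ b, insert m o' (p, b) = (u, cs)
    & cycles_ok o'.2].
  have ow' : perm_eq (word o') (iota m.+1 k).
    case/and3P: Vo => + _ _; rewrite -Eo (permPl (perm_word_insert _ _ le_p)) /=.
    by rewrite perm_cons.
  have gtm : all (ltn m) (word o').
    by rewrite (perm_all _ ow'); apply/allP => x; rewrite mem_iota => /andP[].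
  have mo' := gt_notin gtm.
  rewrite -Eo insertK //=; case/and3P: Vo => _ + _.
  rewrite -Eo word_insert // avoids_insert cat_take_drop //.
  rewrite size_takel ?size_cat ?(leq_trans le_p) ?leq_addr // => /andP[av al].
  by split=> //; [apply/and3P | rewrite mem_choices lt_p].
have [mu|mu] := boolP (m \in u).
  have Eu : take (index m u) u ++ m :: drop (index m u).+1 u = u.
    by rewrite -[RHS](cat_take_drop (index m u)) -(drop_index mu).
  exists (take (index m u) u ++ drop (index m u).+1 u, cs), (index m u), false.
  have le_i : index m u <= size u by rewrite index_size.
  have St : size (take (index m u) u) = index m u by rewrite size_takel.
  split=> /=; rewrite ?size_cat ?St ?leq_addr ?addn1 ?ltnS ?leq_addr //.
    by rewrite /insert /= take_size_cat ?drop_size_cat ?Eu.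
  by case/and3P: Vo.
rewrite mem_cat (negbTE mu) /= in mw.
case/and3P: Vo => ow _ /=; case: cs mw ow => [//|[|a c] cs] //= mw ow.
case/and3P=> lt_c le_a ok.
(* The head [a] is a lower bound of the letters in the cycles, among them [m], while every letter is
   at least [m]. *)
have a_ge : m <= a.
  have : a \in iota m k.+1 by rewrite -(perm_mem ow) /word mem_cat mem_head orbT.
  by rewrite mem_iota => /andP[].
have a_le : a <= m by move: mw; rewrite inE => /predU1P[->|/(allP (andP le_a).2)].
have -> : a = m by apply/eqP; rewrite eqn_leq a_le.
exists (u ++ c, cs), (size u), true; rewrite /insert /= take_size_cat // drop_size_cat //.
by rewrite size_cat leq_addr addn0 -[X in X < _]addn0 ltn_add2l.
Qed.

Lemma partialsS m k : partials m k.+1 =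
  [seq insert m o c | o <- partials m.+1 k, c <- choices o].
Proof. by []. Qed.

Lemma mem_partials m k o : 0 < m -> (o \in partials m k) = valid m k o.
Proof.
elim: k m o => [|k IHk] m o m0.
  rewrite inE; apply/eqP/and3P => [->//|[]]; case: o => [u cs].
  by move=> /perm_nilP; case: u => //=; case: cs => // -[|? ?].
rewrite partialsS.
apply/idP/idP => [/allpairsPdep[o' [c [oP co' ->]]]|/(removalK m0)[Vo' co' <-]].
  by apply: valid_insert co'; rewrite -IHk.
by apply: allpairs_f_dep; rewrite ?IHk.
Qed.

Lemma partials_uniq m k : 0 < m -> uniq (partials m k).
Proof.
elim: k m => [|k IHk] m m0 //; rewrite partialsS; apply: allpairs_uniq_dep => [|o _|].
- exact: IHk.
- exact: choices_uniq.
apply: (can_in_inj (g := fun o => existT (fun=> _) (removal m o).1 (removal m o).2)).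
move=> _ /allpairsPdep[o [[p b] [oP co ->]]] /=.
rewrite mem_partials // in oP; have gtm := valid_gt oP.
have mo := gt_notin gtm.
rewrite insertK //.
by move: co; rewrite mem_choices; case: b => /= /andP[]; lia.
Qed.

(* The level of a partial word is the number of allowed positions strictly inside
   [o.1]. [StP] means that no cycle has been started; otherwise [StA] and [StB]
   tell whether the position just before the first cycle is allowed or not. *)
Inductive state := StP of nat | StA of nat | StB of nat.

Definition level s := match s with StP a | StA a | StB a => a end.

Definition state_of (o : partial) : state :=
  let a := count (allowed (word o)) (iota 0 (size o.1)) in
  if nilp o.2 then StP a
  else if allowed (word o) (size o.1) then StA a else StB a.

(** Only the neighbours of the insertion point change. The place before [m] stays allowed, as [m] is
    smaller than its predecessor; after [m] comes a larger letter, or the default [0] at the end of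
    the word. *)
Lemma allowed_insert m w p q :
  0 < m -> all (ltn m) w -> p <= size w -> allowed w p ->
  allowed (take p w ++ m :: drop p w) q =
    if q <= p then allowed w q
    else if q == p.+1 then p == size w else allowed w q.-1.
Proof.
move=> m0 gtm le_p al; have St : size (take p w) = p by rewrite size_takel.
rewrite /allowed !nth_cat St.
have [lt_qp|lt_pq|->] := ltngtP q p.
- have -> /= : q.-1 < p by lia.
  by rewrite !nth_take //; lia.
- have [-> /=|ne_q] := eqVneq q p.+1.
    rewrite ltnn subnn subSnn /= nth_drop addn0 ltnNge.
    move: le_p; rewrite leq_eqVlt => /predU1P[->|lt_p].
      by rewrite nth_default // eqxx -ltnNge.
    rewrite ltn_eqF //; apply/negbTE; rewrite negbK ltnW //.
    by apply: (allP gtm); rewrite mem_nth.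
  have -> : q.-1 < p = false by lia.
  have [-> ->] : q - p = (q - p.+2).+2 /\ q.-1 - p = (q - p.+2).+1 by lia.
  rewrite /= !nth_drop; have -> : q.-1 = p + (q - p.+2).+1 by lia.
  by case: q lt_pq ne_q => // q; rewrite addnS.
rewrite subnn /=; case: p le_p al St => //= p le_p + _; rewrite {1}/allowed /= => al.
by rewrite ltnSn nth_take // al; apply: (allP gtm); rewrite mem_nth.
Qed.

(** The place before [m] stays allowed, and the new place after [m] is not, since a larger letter
    follows. *)
Lemma count_allowed_insert m w p s :
  0 < m -> all (ltn m) w -> p < s -> s <= size w -> allowed w p ->
  count (allowed (take p w ++ m :: drop p w)) (iota 0 s.+1) =
  count (allowed w) (iota 0 s).
Proof.
move=> m0 gtm lt_ps le_s al.
have -> : s = p.+1 + (s - p.+1) by lia.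
rewrite -addnS !iotaD !count_cat; congr (_ + _).
  apply: eq_in_count => q; rewrite mem_iota => /andP[_ lt_q].
  by rewrite allowed_insert //; [case: leqP; lia | lia].
rewrite [iota _ _.+1]/= [count _ (_ :: _)]/= allowed_insert //; last lia.
rewrite add0n ltnn eqxx (_ : p == size w = false) ?add0n; last lia.
rewrite -(add1n p.+1) iotaDl count_map; apply: eq_in_count => q.
rewrite mem_iota => /andP[lt_pq _] /=; rewrite allowed_insert //; last lia.
by rewrite leqNgt add1n ltnS (ltnW lt_pq) /= eqSS gtn_eqF.
Qed.

Lemma allowed_end o : all (ltn 0) (word o) -> o.2 = [::] ->
  allowed (word o) (size o.1).
Proof.
case: o => [u cs] /= + E; rewrite {}E /word cats0 /= /allowed => gt0.
case: u gt0 => // a u gt0; rewrite nth_default // orFb.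
by apply: (allP gt0); exact: (@mem_nth _ 0 (a :: u)).
Qed.

(** * Effect of an insertion on the state *)

Section States.

Variables (m : nat) (o : partial).
Hypotheses (m0 : 0 < m) (gtm : all (ltn m) (word o)).
Let a := count (allowed (word o)) (iota 0 (size o.1)).

Let size_word : size o.1 <= size (word o).
Proof. by rewrite size_cat leq_addr. Qed.

Lemma state_insert p : p < size o.1 -> allowed (word o) p ->
  state_of (insert m o (p, false)) = state_of o.
Proof.
move=> lt_p al; rewrite /state_of word_insert ?(ltnW lt_p) //.
have -> : size (insert m o (p, false)).1 = (size o.1).+1.
  by rewrite /insert /= size_cat /= size_takel ?(ltnW lt_p) // size_drop; lia.
rewrite (count_allowed_insert m0 gtm lt_p size_word al).
rewrite allowed_insert //; last lia.
have -> : (size o.1 < p) = false by lia.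
by rewrite eqSS gtn_eqF.
Qed.

(** The old end becomes an allowed inner position. The new end comes right after [m], so it is
    allowed only if no cycle follows. *)
Lemma state_insert_end : cycles_ok o.2 -> allowed (word o) (size o.1) ->
  state_of (insert m o (size o.1, false)) =
  if nilp o.2 then StP a.+1 else StB a.+1.
Proof.
move=> ok al; rewrite /state_of word_insert //.
have -> : size (insert m o (size o.1, false)).1 = (size o.1).+1.
  by rewrite /insert /= size_cat /= size_takel // drop_size addn1.
have -> : count (allowed (take (size o.1) (word o) ++ m :: drop (size o.1) (word o)))
    (iota 0 (size o.1).+1) = a.+1.
  rewrite -addn1 iotaD count_cat /= allowed_insert // leqnn al /= addn0 addn1.
  congr _.+1; apply: eq_in_count => q.
  by rewrite mem_iota => /andP[_ lt_q]; rewrite allowed_insert // (ltnW lt_q).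
rewrite allowed_insert // ltnn eqxx /= size_cat -[X in X == _]addn0 eqn_add2l.
by case: o.2 ok => // -[].
Qed.

(** Positions to the right of [p] are frozen inside the new cycle, and [p] itself survives as the
    allowed place just before it, whence [StA]. *)
Lemma state_insert_cycle p : p < size o.1 -> allowed (word o) p ->
  state_of (insert m o (p, true)) = StA (count (allowed (word o)) (iota 0 p)).
Proof.
move=> lt_p al; rewrite /state_of word_insert ?(ltnW lt_p) //=.
rewrite size_takel ?(ltnW lt_p) // allowed_insert ?leqnn ?al //; last lia.
congr StA; apply: eq_in_count => q; rewrite mem_iota => /andP[_ lt_q].
by rewrite allowed_insert // ?(ltnW lt_q) //; lia.
Qed.

End States.

(** * Standard cycle forms *)

Definition letter n (i : 'I_n) : nat := i.+1.

Lemma letter_inj n : injective (@letter n).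
Proof. by move=> i j [/val_inj]. Qed.

Definition letters n (cs : seq (seq 'I_n)) : seq (seq nat) :=
  map (map (@letter n)) cs.

Lemma flatten_letters n (cs : seq (seq 'I_n)) :
  flatten (letters cs) = map (@letter n) (flatten cs).
Proof. by rewrite map_flatten. Qed.

Lemma letters_inj n : injective (@letters n).
Proof. exact/inj_map/inj_map/letter_inj. Qed.

Lemma map_letter_enum n : map (@letter n) (enum 'I_n) = iota 1 n.
Proof. by rewrite (map_comp succn val) val_enum_ord -(iotaDl 1 0). Qed.

Lemma ord_ltn_trans n : transitive (fun i j : 'I_n => i < j).
Proof. by move=> i j k; apply: ltn_trans. Qed.

Lemma enum_ord_sorted n : sorted (fun i j : 'I_n => i < j) (enum 'I_n).
Proof.
by have := iota_ltn_sorted 0 n; rewrite -val_enum_ord sorted_map.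
Qed.

Section CycleForm.

Variables (n : nat) (s : {perm 'I_n}).

Lemma porbit_orbit x : porbit s x =i orbit s x.
Proof.
move=> y; rewrite -fconnect_orbit; apply/porbitP/idP => [[i ->]|/iter_findex <-].
  by rewrite permX fconnect_iter.
by exists (findex s x y); rewrite permX.
Qed.

Lemma cycle_minP m :
  reflect (forall x, x \in orbit s m -> m <= x) (cycle_min s m).
Proof.
apply: (iffP forall_inP) => H x; [rewrite -porbit_orbit|rewrite porbit_orbit];
exact: H.
Qed.

Lemma orbit_cycle_min x : exists2 m, cycle_min s m & x \in orbit s m.
Proof.
case: (@arg_minnP _ x (mem (orbit s x)) (@nat_of_ord n)); first exact: in_orbit.
move=> m /= xm min_m; have mx : x \in orbit s m.
  by rewrite -porbit_orbit porbit_sym porbit_orbit.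
exists m => //; apply/cycle_minP => y ym; apply: min_m.
by move: mx ym xm; rewrite /= -!porbit_orbit -!eq_porbit_mem => /eqP-> /eqP->.
Qed.

Lemma cycle_min_inj m1 m2 x : cycle_min s m1 -> cycle_min s m2 ->
  x \in orbit s m1 -> x \in orbit s m2 -> m1 = m2.
Proof.
move=> /cycle_minP min1 /cycle_minP min2.
rewrite -!porbit_orbit -!eq_porbit_mem => /eqP E1 /eqP E2.
apply/val_inj/eqP; rewrite /= eqn_leq min1 ?min2 // -porbit_orbit -eq_porbit_mem.
  by rewrite -E1 E2.
by rewrite -E1 E2.
Qed.

Lemma perm_cycle_form : perm_eq (flatten (standard_cycle_form s)) (enum 'I_n).
Proof.
apply: uniq_perm; rewrite ?enum_uniq //.
  (* The flattening is seen as a list of pairs (cycle minimum, element of its orbit), so it has no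
     repetition because orbits of distinct minima are disjoint. *)
  have := @allpairs_uniq_dep _ (fun=> 'I_n) _ (fun _ y => y)
            [seq m <- enum 'I_n | cycle_min s m] (fun m => orbit s m).
  rewrite /= (eq_map (g := orbit s)) => [|m]; last by rewrite map_id.
  apply; first by rewrite filter_uniq ?enum_uniq.
    by move=> m _; apply: orbit_uniq.
  move=> _ _ /allpairsPdep[m1 [x1 [M1 X1 ->]]] /allpairsPdep[m2 [x2 [M2 X2 ->]]] /= E.
  move: M1 M2 X1 X2; rewrite !mem_filter {}E => /andP[M1 _] /andP[M2 _] X1 X2.
  by rewrite (cycle_min_inj M1 M2 X1 X2).
move=> x; rewrite mem_enum; have [m M xm] := orbit_cycle_min x.
apply/flatten_mapP; exists m => //.
by rewrite mem_filter M mem_enum.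
Qed.

Lemma flatE : flat s = flatten (letters (standard_cycle_form s)).
Proof. by rewrite flatten_letters. Qed.

Lemma perm_flat : perm_eq (flat s) (iota 1 n).
Proof. by rewrite -map_letter_enum; exact/perm_map/perm_cycle_form. Qed.

Lemma orbit_cons m : orbit s m = m :: behead (orbit s m).
Proof. by rewrite /orbit -orderSpred. Qed.

Lemma size_orbit_gt1 m : (1 < size (orbit s m)) = (s m != m).
Proof.
have [sm|ne_sm] := eqVneq (s m) m.
  have cm : fcycle s [:: m] by rewrite /= sm eqxx.
  by rewrite (orbitE cm) // ?mem_head // size_rot.
have : s m \in orbit s m by rewrite -fconnect_orbit fconnect1.
by rewrite orbit_cons; case: behead => //; rewrite inE (negbTE ne_sm).
Qed.

(** The order conditions hold in every standard cycle form; only the length condition restricts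
    [s]. *)
Lemma cycles_ok_cycle_form :
  cycles_ok (letters (standard_cycle_form s)) = derangement s.
Proof.
apply/idP/idP => [ok|/forallP der].
  have sz c : c \in standard_cycle_form s -> 1 < size c.
    elim: (standard_cycle_form s) ok => //= d cs IH /and3P[sd _ /IH{}IH].
    by rewrite inE => /predU1P[->|/IH//]; rewrite size_map in sd.
  apply/forallP => x; rewrite -size_orbit_gt1; have [m M xm] := orbit_cycle_min x.
  have /sz : orbit s m \in standard_cycle_form s.
    by apply: map_f; rewrite mem_filter M mem_enum.
  rewrite !size_orbit; congr (1 < _); apply/eq_card => y.
  rewrite !inE !fconnect_orbit -!porbit_orbit.
  by move: xm; rewrite -porbit_orbit -eq_porbit_mem => /eqP->.
have : sorted (fun i j : 'I_n => i < j) [seq m <- enum 'I_n | cycle_min s m].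
  by apply: sorted_filter; [exact: ord_ltn_trans | exact: enum_ord_sorted].
have : all (cycle_min s) [seq m <- enum 'I_n | cycle_min s m] by exact: filter_all.
rewrite /standard_cycle_form; elim: [seq _ <- _ | _] => //= m ms IH /andP[M Ms] pm.
rewrite IH ?(path_sorted pm) // size_map size_orbit_gt1 der /= andbT.
have -> : head 0 (map (@letter n) (orbit s m)) = m.+1 by rewrite orbit_cons.
rewrite all_cat; apply/andP; split.
  by apply/allP => _ /mapP[x xm ->]; rewrite ltnS; move/cycle_minP: M; apply.
apply/allP => x /flattenP[_ /mapP[_ /mapP[m' m'P ->] ->]] /mapP[y ym' ->].
rewrite ltnS (@leq_trans m') //.
  by apply: ltnW; apply: (allP (order_path_min (@ord_ltn_trans n) pm)) m'P.
by have /cycle_minP := allP Ms _ m'P; apply.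
Qed.

Lemma mu_cycle_form : mu s = size (standard_cycle_form s).
Proof.
rewrite /mu size_map /porbits.
have -> : porbit s @: 'I_n = porbit s @: [set m in [seq m <- enum 'I_n | cycle_min s m]].
  apply/setP => A; apply/imsetP/imsetP => [[x _ ->]|[x _ ->]]; last by exists x.
  have [m M xm] := orbit_cycle_min x; exists m.
    by rewrite inE mem_filter M mem_enum.
  by apply/eqP; rewrite eq_porbit_mem porbit_orbit.
rewrite card_in_imset => [|m1 m2].
  by rewrite cardsE; apply/card_uniqP; rewrite filter_uniq ?enum_uniq.
rewrite !inE !mem_filter => /andP[M1 _] /andP[M2 _] E.
apply: (cycle_min_inj M1 M2 (in_orbit _ _)).
by rewrite -porbit_orbit -E porbit_id.
Qed.

End CycleForm.

(** The image of [x] is read off as its cyclic successor in the cycle containing it. *)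
Lemma standard_cycle_form_inj n : injective (@standard_cycle_form n).
Proof.
move=> s t E; apply/permP => x; have [m M xm] := orbit_cycle_min s x.
have : orbit s m \in standard_cycle_form s.
  by apply: map_f; rewrite mem_filter M mem_enum.
rewrite E => /mapP[m' _ E'].
rewrite -(nextE (cycle_orbit (@perm_inj _ s) m) xm) E'.
by rewrite (nextE (cycle_orbit (@perm_inj _ t) m')) // -E'.
Qed.

(** The product of the listed cycles: [next c] fixes every element outside [c]. *)
Definition next_in (T : eqType) (cs : seq (seq T)) (x : T) : T :=
  foldr (fun c y => next c y) x cs.

Lemma next_in_out (T : eqType) (cs : seq (seq T)) x :
  x \notin flatten cs -> next_in cs x = x.
Proof.
elim: cs => //= c cs IH; rewrite mem_cat negb_or => /andP[xc /IH->].
by rewrite next_nth (negbTE xc).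
Qed.

Lemma next_inE (T : eqType) (cs : seq (seq T)) c x :
  uniq (flatten cs) -> c \in cs -> x \in c -> next_in cs x = next c x.
Proof.
elim: cs => //= d cs IH; rewrite cat_uniq => /and3P[_ /hasPn dj U].
rewrite inE => /predU1P[->|c_cs] xc.
  by rewrite next_in_out //; apply/negP => /dj; rewrite xc.
rewrite IH // [LHS]next_nth ifN //; apply: dj.
by apply/flattenP; exists c; rewrite // mem_next.
Qed.

Lemma next_in_inj (T : eqType) (cs : seq (seq T)) :
  uniq (flatten cs) -> injective (next_in cs).
Proof.
elim: cs => [|c cs IH] /=; first by move=> _ x y.
rewrite cat_uniq => /and3P[Uc _ /IH inj]; exact: inj_comp (can_inj (prev_next Uc)) inj.
Qed.

Lemma standard_cycle_form_surj n (cs : seq (seq 'I_n.+1)) :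
  perm_eq (flatten cs) (enum 'I_n.+1) -> cycles_ok (letters cs) ->
  exists s, standard_cycle_form s = cs.
Proof.
move=> cs_perm cs_ok.
have U : uniq (flatten cs) by rewrite (perm_uniq cs_perm) enum_uniq.
have Uc c : c \in cs -> uniq c.
  elim: (cs) U => //= d cs' IH; rewrite cat_uniq => /and3P[Ud _ /IH{}IH].
  by rewrite inE => /predU1P[->|/IH].
pose s := perm (next_in_inj U); exists s.
have orbE c x : c \in cs -> x \in c -> orbit s x = rot (index x c) c.
  move=> c_cs xc; apply: orbitE (Uc _ c_cs) _ xc.
  have Ec : {in c &, frel s =2 frel (next c)}.
    by move=> y z yc _; rewrite /= permE (next_inE U c_cs).
  rewrite (eq_in_cycle Ec) ?cycle_next ?Uc //; apply/allP => y; apply.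
have okc c : c \in cs -> 0 < size c /\ forall x, x \in c -> head ord0 c <= x.
  elim: (cs) cs_ok => //= d cs' IH /and3P[sd le_d /IH{}IH].
  rewrite inE => /predU1P[->|/IH//]; rewrite size_map in sd.
  split; first exact: ltnW; move=> x xd.
  case: d sd le_d xd => //= a d _ le_d xd.
  move: xd; rewrite inE => /predU1P[->//|xd].
  case/andP: le_d => _ /allP/(_ (letter x)); rewrite mem_cat.
  by rewrite (map_f (@letter n.+1) xd); apply.
have head_in c : c \in cs -> head ord0 c \in c.
  by case/okc; case: c => // a c _ _; rewrite mem_head.
(* Both lists are strictly increasing, so equality of their sets of elements is enough. *)
have minE : [seq m <- enum 'I_n.+1 | cycle_min s m] = map (head ord0) cs.
  apply: (@irr_sorted_eq _ (fun i j : 'I_n.+1 => i < j)).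
  - exact: ord_ltn_trans.
  - by move=> ?; rewrite ltnn.
  - by apply: sorted_filter; [exact: ord_ltn_trans | exact: enum_ord_sorted].
  - rewrite sorted_pairwise; last exact: ord_ltn_trans.
    elim: (cs) cs_ok (U) head_in => //= c cs' IH /and3P[_ le_c ok].
    rewrite cat_uniq => /and3P[_ /hasPn dj U'] h_in.
    rewrite IH //; last by move=> d d_cs'; apply: h_in; rewrite inE d_cs' orbT.
    rewrite andbT; apply/allP => _ /mapP[d d_cs' ->].
    have hc := h_in c (mem_head _ _).
    have hd := h_in d; rewrite inE d_cs' orbT in hd; have {}hd := hd isT.
    have d_fl : head ord0 d \in flatten cs' by apply/flattenP; exists d.
    rewrite ltn_neqAle; apply/andP; split.
      by apply/negP => /eqP/val_inj E; move: (dj _ d_fl); rewrite -E hc.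
    case: c le_c hc {h_in dj} => //= a c /andP[_]; rewrite all_cat => /andP[_ le_c] _.
    have := allP le_c (letter (head ord0 d)); apply.
    by rewrite flatten_letters map_f.
  move=> m; rewrite mem_filter mem_enum andbT.
  apply/cycle_minP/mapP => [min_m|[c c_cs ->] x].
    have /flattenP[c c_cs mc] : m \in flatten cs by rewrite (perm_mem cs_perm) mem_enum.
    exists c => //; apply/val_inj/eqP; rewrite eqn_leq (proj2 (okc _ c_cs)) // andbT.
    by apply: min_m; rewrite (orbE _ _ c_cs mc) mem_rot head_in.
  by rewrite (orbE _ _ c_cs (head_in _ c_cs)) mem_rot; exact: (proj2 (okc _ c_cs)).
rewrite /standard_cycle_form minE -map_comp -[RHS]map_id; apply/eq_in_map => c c_cs /=.
rewrite (orbE _ _ c_cs (head_in _ c_cs)).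
by case/okc: c_cs; case: c => // a c _ _; rewrite /= eqxx rot0.
Qed.

(** In a complete word every letter belongs to a marked cycle, so the part before the first cycle is
    empty. *)
Lemma mem_cycle_forms n cs :
  (cs \in [seq letters (standard_cycle_form s) | s in D_21_3 n.+1]) =
  valid 1 n.+1 ([::], cs).
Proof.
have Uflat (s : {perm 'I_n.+1}) : uniq (flat s).
  by rewrite (perm_uniq (perm_flat s)) iota_uniq.
apply/mapP/and3P => [[s]|[csP av ok]].
  rewrite mem_enum inE => /andP[der av ->]; rewrite /word /= -flatE; split.
  - exact: perm_flat.
  - by rewrite -contains_avoids.
  - by rewrite cycles_ok_cycle_form.
rewrite /word /= in csP av ok.
pose ocs := map (map (fun k => inord k.-1 : 'I_n.+1)) cs.
have Ecs : letters ocs = cs.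
  rewrite /letters /ocs -map_comp -[RHS]map_id; apply/eq_in_map => c c_cs /=.
  rewrite -map_comp -[RHS]map_id; apply/eq_in_map => k kc /=.
  have : k \in iota 1 n.+1 by rewrite -(perm_mem csP); apply/flattenP; exists c.
  by rewrite mem_iota /letter => k_in; rewrite inordK; lia.
have [s Es] : exists s, standard_cycle_form s = ocs.
  apply: standard_cycle_form_surj; last by rewrite Ecs.
  by apply: (perm_map_inj (@letter_inj _)); rewrite map_letter_enum -flatten_letters Ecs.
exists s; last by rewrite Es.
rewrite mem_enum inE contains_avoids // flatE Es Ecs av andbT.
by rewrite -cycles_ok_cycle_form Es Ecs.
Qed.

Local Open Scope ring_scope.

(** * The ring of formal power series *)

Section FpsRing.
Variable R : comUnitRingType.
Implicit Types (a b c : fps R) (p q : {poly R}).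

Lemma fpsP a b : a =1 b -> a = b. Proof. exact: funext. Qed.

Definition fps_zero : fps R := fun=> 0.
Definition fps_opp a : fps R := fun n => - a n.
Definition fps_add a b : fps R := fun n => a n + b n.
Definition fps_one : fps R := fps_of_poly 1.

Lemma fps_addA : associative fps_add.
Proof. by move=> a b c; apply: fpsP => n; apply: addrA. Qed.
Lemma fps_addC : commutative fps_add.
Proof. by move=> a b; apply: fpsP => n; apply: addrC. Qed.
Lemma fps_add0 : left_id fps_zero fps_add.
Proof. by move=> a; apply: fpsP => n; apply: add0r. Qed.
Lemma fps_addN : left_inverse fps_zero fps_opp fps_add.
Proof. by move=> a; apply: fpsP => n; apply: addNr. Qed.

HB.instance Definition _ := gen_eqMixin (fps R).
HB.instance Definition _ := gen_choiceMixin (fps R).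
HB.instance Definition _ :=
  GRing.isZmodule.Build (fps R) fps_addA fps_addC fps_add0 fps_addN.

(** Coefficient [n] of a product involves only coefficients up to [n], so the ring axioms are
    inherited from polynomial truncations. *)
Lemma coef_fps_mul a b p q n :
  (forall i, (i <= n)%N -> p`_i = a i) -> (forall i, (i <= n)%N -> q`_i = b i) ->
  fps_mul a b n = (p * q)`_n.
Proof.
move=> pa qb; rewrite coefM; apply: eq_bigr => i _.
by rewrite pa ?qb ?leq_subr // -ltnS.
Qed.

Let trunc N a : {poly R} := \poly_(i < N) a i.

Let coef_trunc n a i : (i <= n)%N -> (trunc n.+1 a)`_i = a i.
Proof. by move=> le_in; rewrite coef_poly ltnS le_in. Qed.

Let coef_truncM n a b i :
  (i <= n)%N -> (trunc n.+1 a * trunc n.+1 b)`_i = fps_mul a b i.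
Proof.
move=> le_in; symmetry; apply: coef_fps_mul => k le_ki;
by apply: coef_trunc; apply: leq_trans le_ki le_in.
Qed.

Lemma fps_mulA : associative (@fps_mul R).
Proof.
move=> a b c; apply: fpsP => n.
rewrite (coef_fps_mul (@coef_trunc n a) (@coef_truncM n b c)).
by rewrite (coef_fps_mul (@coef_truncM n a b) (@coef_trunc n c)) mulrA.
Qed.

Lemma fps_mulC : commutative (@fps_mul R).
Proof.
move=> a b; apply: fpsP => n.
rewrite (coef_fps_mul (@coef_trunc n a) (@coef_trunc n b)) mulrC.
by rewrite -(coef_fps_mul (@coef_trunc n b) (@coef_trunc n a)).
Qed.

Lemma fps_mul1 : left_id fps_one (@fps_mul R).
Proof.
move=> a; apply: fpsP => n.
rewrite (@coef_fps_mul _ _ 1 _ _ _ (@coef_trunc n a)) // mul1r.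
exact: coef_trunc.
Qed.

Lemma fps_mulDl : left_distributive (@fps_mul R) fps_add.
Proof.
move=> a b c; apply: fpsP => n; rewrite /fps_add /fps_mul -big_split.
by apply: eq_bigr => i _; rewrite mulrDl.
Qed.

Lemma fps_1neq0 : fps_one != 0.
Proof.
apply/eqP=> /(congr1 (fun a : fps R => a 0%N)) /eqP.
by rewrite /fps_one /fps_of_poly coef1 /= oner_eq0.
Qed.

HB.instance Definition _ := GRing.Zmodule_isComNzRing.Build (fps R)
  fps_mulA fps_mulC fps_mul1 fps_mulDl fps_1neq0.

Lemma fps_of_poly_zmod_morphism : zmod_morphism (@fps_of_poly R).
Proof. by move=> p q; apply: fpsP => n; rewrite /fps_of_poly coefB. Qed.

Lemma fps_of_poly_monoid_morphism : monoid_morphism (@fps_of_poly R).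
Proof. by split=> // p q; apply: fpsP => n; rewrite /fps_of_poly coefM. Qed.

HB.instance Definition _ := GRing.isZmodMorphism.Build {poly R} (fps R)
  (@fps_of_poly R) fps_of_poly_zmod_morphism.
HB.instance Definition _ := GRing.isMonoidMorphism.Build {poly R} (fps R)
  (@fps_of_poly R) fps_of_poly_monoid_morphism.

Lemma fpsD a b n : (a + b) n = a n + b n. Proof. by []. Qed.
Lemma fps_sum (I : Type) (r : seq I) (F : I -> fps R) n :
  (\sum_(i <- r) F i) n = \sum_(i <- r) F i n.
Proof. by elim/big_rec2: _ => // i x y _ <-. Qed.

Lemma fpsCM (c : R) a n : (fps_of_poly c%:P * a) n = c * a n.
Proof.
rewrite [LHS](@coef_fps_mul _ _ c%:P _ _ _ (@coef_trunc n a)) //.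
by rewrite coefCM coef_trunc.
Qed.

Lemma fpsXnM k a n : (fps_of_poly 'X^k * a) n = if (n < k)%N then 0 else a (n - k)%N.
Proof.
rewrite [LHS](@coef_fps_mul _ _ 'X^k _ _ _ (@coef_trunc n a)) //.
by rewrite coefXnM; case: ltnP => // _; rewrite coef_trunc ?leq_subr.
Qed.

Lemma fpsXM a n : (fps_of_poly 'X * a) n = if n is k.+1 then a k else 0.
Proof. by rewrite -(expr1 'X) fpsXnM; case: n => // n; rewrite subSS subn0. Qed.

End FpsRing.

(** * The transfer operator and its generating functions *)

(* The first term counts the insertions of a new smallest letter at the allowed
   positions inside [o.1], the second one the insertion at its end, and the third
   one the insertions that start a new cycle. *)
Definition transfer (g : state -> {poly int}) (s : state) : {poly int} :=
  g s *+ level s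
  + match s with StP a => g (StP a.+1) | StA a => g (StB a.+1) | StB _ => 0 end
  + 'X * \sum_(c < level s) g (StA c).

(** Coefficient [k] is the sum over marked words with [k] letters of ['X] to the number of cycles
    times [g] at the state. [transfer] acts on the test function [g], dually to the insertions
    acting on words. *)
Definition weight (g : state -> {poly int}) : fps {poly int} :=
  fun k => iter k transfer g (StP 0).

Definition genP a := weight (fun s => if s is StP b then (b == a)%:R else 0).
Definition genA a := weight (fun s => if s is StA b then (b == a)%:R else 0).
Definition genB a := weight (fun s => if s is StB b then (b == a)%:R else 0).
Definition genT a := weight (fun s => (a < level s)%:R).

Lemma eq_transfer g h : g =1 h -> transfer g =1 transfer h.
Proof.
move=> gh s; rewrite /transfer gh; congr (_ + _ + _ * _); first by case: s.
exact: eq_bigr.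
Qed.

Lemma eq_weight g h : g =1 h -> weight g = weight h.
Proof.
move=> gh; apply: fpsP => k; rewrite /weight.
by elim: k (StP 0) => //= k IHk s; apply: eq_transfer.
Qed.

Lemma weightS g k : weight g k.+1 = weight (transfer g) k.
Proof. by rewrite /weight iterSr. Qed.

Lemma transferD g h s : transfer (fun t => g t + h t) s = transfer g s + transfer h s.
Proof.
rewrite /transfer mulrnDl big_split mulrDr /=.
case: s => a; rewrite ?addr0 /=; ring.
Qed.

Lemma transferZ c g s : transfer (fun t => c * g t) s = c * transfer g s.
Proof.
rewrite /transfer -mulr_sumr -mulrnAr.
case: s => a; rewrite ?addr0 /=; ring.
Qed.

Lemma weightD g h : weight (fun s => g s + h s) = weight g + weight h.
Proof.
apply: fpsP => k; rewrite fpsD /weight.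
elim: k (StP 0) => //= k IHk s; rewrite -transferD; exact: eq_transfer.
Qed.

Lemma weightZ c g : weight (fun s => c * g s) = fps_of_poly c%:P * weight g.
Proof.
apply: fpsP => k; rewrite fpsCM /weight.
elim: k (StP 0) => //= k IHk s; rewrite -transferZ; exact: eq_transfer.
Qed.

Lemma weight_rec g h : g (StP 0) = 0 -> transfer g =1 h ->
  weight g = fps_of_poly 'X * weight h.
Proof.
move=> g0 gh; apply: fpsP => -[|k]; rewrite fpsXM // weightS.
by rewrite (eq_weight gh).
Qed.

(** The level starts at 0 and rises by at most one per insertion. *)
Lemma weight_vanish g k : (forall s, (level s <= k)%N -> g s = 0) -> weight g k = 0.
Proof.
elim: k g => [|k IHk] g g0; first exact: g0.
rewrite weightS; apply: IHk => s le_sk; rewrite /transfer g0 ?leqW // mul0rn add0r.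
rewrite big1 ?mulr0 ?addr0 => [|c _]; last first.
  by rewrite g0 //= ltnW // (leq_trans (ltn_ord c)) // leqW.
by case: s le_sk => // a le_ak; rewrite g0.
Qed.

Local Notation X := (fps_of_poly x_).
Local Notation Y := (fps_of_poly y_).

Lemma genT_vanish a k : (k <= a)%N -> genT a k = 0.
Proof.
by move=> le_ka; apply: weight_vanish => s le_sk; rewrite ltnNge (leq_trans le_sk).
Qed.

(** Position 0 is always allowed, so only the empty word has level 0 and no cycle. *)
Lemma genP0 : genP 0 = 1.
Proof.
apply: fpsP => -[|k]; first by rewrite [RHS]coef1.
rewrite /genP weightS.
rewrite [RHS]coef1 /=.
apply: weight_vanish => s _.
rewrite /transfer big1 ?mulr0 ?addr0; last by [].
by case: s => // -[|a]; rewrite ?mulr0n ?mul0rn ?addr0.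
Qed.

(** Level [a.+1] is kept by insertion at one of the [a.+1] inner positions, or reached from level
    [a] by insertion at the end. *)
Lemma genP_rec a : (1 - a.+1%:R * X) * genP a.+1 = X * genP a.
Proof.
have -> : X * genP a = genP a.+1 - a.+1%:R * X * genP a.+1; last by ring.
rewrite {2}/genP (weight_rec (h := fun s =>
  a.+1%:R * (if s is StP b then (b == a.+1)%:R else 0)
  + (if s is StP b then (b == a)%:R else 0))) //.
  rewrite weightD weightZ -/(genP a) -/(genP a.+1) polyC_natr rmorph_nat; ring.
move=> s; rewrite /transfer [X in 'X * X]big1 // mulr0 addr0.
case: s => b; rewrite ?mul0rn ?mulr0 ?addr0 //= eqSS mulr_natl; congr (_ + _).
by case: eqP => [->|_]; rewrite ?mul0rn.
Qed.

(** Besides the [a] inner insertions, [StA a] arises by starting a cycle at the one allowed position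
    with [a] others before it; it exists when the level exceeds [a]. *)
Lemma genA_rec a : (1 - a%:R * X) * genA a = X * Y * genT a.
Proof.
have -> : X * Y * genT a = genA a - a%:R * X * genA a; last by ring.
rewrite {1}/genA (weight_rec (h := fun s =>
  a%:R * (if s is StA b then (b == a)%:R else 0) + 'X * (a < level s)%:R)) //.
  rewrite weightD !weightZ -/(genA a) -/(genT a) polyC_natr rmorph_nat; ring.
move=> s; rewrite /transfer -addrA; congr (_ + _).
  case: s => b; rewrite ?mul0rn ?mulr0 //= mulr_natl.
  by case: eqP => [->|_]; rewrite ?mul0rn.
have -> : (if s is StA b then 0 else 0) = 0 :> {poly int} by case: s.
have -> : \sum_(c < level s) (c == a :> nat)%:R = (a < level s)%:R :> {poly int}.
  rewrite -(big_mkord xpredT (fun c => (c == a)%:R)).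
  elim: (level s) => [|k IHk]; first by rewrite big_geq.
  rewrite big_nat_recr //= IHk ltnS.
  by case: ltngtP => _; rewrite ?addr0 ?add0r.
by case: s => b; rewrite add0r.
Qed.

(** The place before the first cycle stops being allowed only through an insertion there, which
    raises the level. *)
Lemma genB_rec a : (1 - a.+1%:R * X) * genB a.+1 = X * genA a.
Proof.
have -> : X * genA a = genB a.+1 - a.+1%:R * X * genB a.+1; last by ring.
rewrite {1}/genB (weight_rec (h := fun s =>
  a.+1%:R * (if s is StB b then (b == a.+1)%:R else 0)
  + (if s is StA b then (b == a)%:R else 0))) //.
  rewrite weightD weightZ -/(genB a.+1) -/(genA a) polyC_natr rmorph_nat; ring.
move=> s; rewrite /transfer [X in 'X * X]big1 // mulr0 addr0.
case: s => b; rewrite ?mul0rn ?mulr0 ?addr0 ?add0r //= mulr_natl.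
by case: eqP => [->|_]; rewrite ?mul0rn.
Qed.

Lemma genT_rec a : genT a = genT a.+1 + genP a.+1 + genA a.+1 + genB a.+1.
Proof.
rewrite -!weightD; apply: eq_weight => s.
case: s => b /=; rewrite leq_eqVlt (eq_sym a.+1);
by case: ltngtP => //= _; rewrite ?addr0 ?add0r.
Qed.

Definition factors (i : nat) : fps {poly int} := \prod_(1 <= c < i.+1) (1 - c%:R * X).

Lemma factorsS i : factors i.+1 = factors i * (1 - i.+1%:R * X).
Proof. by rewrite /factors big_nat_recr. Qed.

Lemma factors_genP i : factors i * genP i = X ^+ i.
Proof.
elim: i => [|i IHi]; first by rewrite /factors big_geq // genP0 mul1r.
by rewrite factorsS -mulrA genP_rec mulrCA IHi exprS.
Qed.

(* [factors i.-1] clears the denominators of the recurrence satisfied by [genT]. *)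
Definition genV i := factors i.-1 * genT i.

Lemma genV_rec i :
  ((1 - i%:R * X) * (1 - i.+1%:R * X) - X ^+ 2 * Y) * genV i =
  (1 - i.+1%:R * X + X * Y) * genV i.+1 + X ^+ i.+1.
Proof.
have fE : (1 - i%:R * X) * factors i.-1 = factors i.
  by case: i => [|i]; rewrite ?mul0r ?subr0 ?mul1r // factorsS mulrC.
have key : ((1 - i%:R * X) * (1 - i.+1%:R * X) - X ^+ 2 * Y) * genT i =
   (1 - i%:R * X) * ((1 - i.+1%:R * X + X * Y) * genT i.+1 + X * genP i).
  have := genP_rec i; have := genB_rec i; have := genA_rec i.
  have := genA_rec i.+1; have := genT_rec i.
  move: (genT i) (genT i.+1) (genP i) (genP i.+1) (genA i) (genA i.+1) (genB i.+1).
  move: X Y (i%:R : fps {poly int}) (i.+1%:R : fps {poly int}) => x y n m.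
  move=> t t' p p' a a' b Et Ea' Ea Eb Ep.
  (* Eliminates A_i: once T_i is expanded by [genT_rec] in the other term, the contributions of
     B_(i+1) cancel. *)
  have {Ea Eb} Exyt : x ^+ 2 * y * t = (1 - n * x) * ((1 - m * x) * b).
    by rewrite Eb mulrCA Ea; ring.
  rewrite mulrBl Exyt Et -Ep mulrDr.
  have -> : (1 - m * x + x * y) * t' = (1 - m * x) * t' + (1 - m * x) * a'.
    by rewrite Ea'; ring.
  ring.
rewrite /genV /= mulrCA key mulrA [_ * (1 - _)]mulrC fE mulrDr.
rewrite exprS -factors_genP; ring.
Qed.


(** * Iteration of the relation for [genV] *)

Definition den_factor (i : nat) : {poly {poly int}} :=
  1 - (2 * i + 1)%:R * x_ + (i * (i + 1))%:R * x_ ^+ 2 - x_ ^+ 2 * y_.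

Definition num_factor (i : nat) : {poly {poly int}} := 1 - i%:R * x_ + x_ * y_.

Lemma fps_of_den_factor i :
  fps_of_poly (den_factor i) = (1 - i%:R * X) * (1 - i.+1%:R * X) - X ^+ 2 * Y.
Proof.
rewrite -!(rmorph_nat (@fps_of_poly _)) -!rmorphXn -(rmorph1 (@fps_of_poly _)).
rewrite -!rmorphM -!rmorphB -!rmorphM -rmorphB; congr fps_of_poly.
rewrite /den_factor natrD !natrM natrD -natr1; ring.
Qed.

Lemma fps_of_num_factor i :
  fps_of_poly (num_factor i) = 1 - i%:R * X + X * Y.
Proof. by rewrite rmorphD rmorphB !rmorphM rmorph_nat rmorph1. Qed.

Definition summand j :=
  fps_div (fps_of_poly (U_num j)) (fps_of_poly (U_den j)) : fps {poly int}.

Definition inv_den (j : nat) : fps {poly int} := fps_inv (fps_of_poly (U_den j)).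

Lemma U_den_inv j : fps_of_poly (U_den j) * inv_den j = 1.
Proof. by apply: fpsP; apply: fps_mulV; rewrite /fps_of_poly coef0_U_den unitr1. Qed.

Lemma U_denS j : U_den j.+1 = U_den j * den_factor j.+1.
Proof. by rewrite /U_den big_nat_recr. Qed.

Lemma inv_denS j : inv_den j = fps_of_poly (den_factor j.+1) * inv_den j.+1.
Proof.
have := U_den_inv j.+1; rewrite U_denS rmorphM /= => E.
rewrite -[LHS]mulr1 -[RHS]mul1r -{1}E -(U_den_inv j).
ring.
Qed.

(** This is [genV_rec] applied for [i] from 0 to [M]; the second term is the remainder. The outer
    [X] turns the x^j of [U_num j] into the inhomogeneous term x^(j+1). *)
Lemma partial_sum M :
  X * \sum_(j < M.+1) summand j
  + fps_of_poly (\prod_(1 <= i < M.+2) num_factor i) * genV M.+1 * inv_den M = genV 0.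
Proof.
elim: M => [|M IHM].
  rewrite big_ord1 big_nat1 fps_of_num_factor /summand.
  have -> : U_num 0 = 1 by rewrite /U_num big_geq // mulr1.
  have -> : fps_div (fps_of_poly 1) (fps_of_poly (U_den 0)) = inv_den 0.
    exact: fps_mul1.
  have := genV_rec 0; rewrite -fps_of_den_factor expr1.
  have -> : den_factor 0 = U_den 0 by rewrite /U_den big_nat1.
  move=> E; have -> : genV 0 = fps_of_poly (U_den 0) * genV 0 * inv_den 0.
    by rewrite mulrAC U_den_inv mul1r.
  by rewrite E; ring.
rewrite -IHM big_ord_recr /= (@big_nat_recr _ _ _ M.+2) //= rmorphM /=.
rewrite (inv_denS M).
have -> : summand M.+1 =
  X ^+ M.+1 * fps_of_poly (\prod_(1 <= i < M.+2) num_factor i) * inv_den M.+1.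
  by rewrite -rmorphXn -rmorphM.
have := genV_rec M.+1; rewrite -fps_of_den_factor -fps_of_num_factor => E.
set p := fps_of_poly (\prod_(1 <= i < M.+2) _).
set d := fps_of_poly (den_factor _) in E *.
have -> : p * genV M.+1 * (d * inv_den M.+1) = p * (d * genV M.+1) * inv_den M.+1 by ring.
rewrite E [X ^+ M.+2]exprS; ring.
Qed.

Lemma U_gen_sum : exists S : fps {poly int},
  fps_has_sum summand S /\ genA 0 =1 fps_mul (fps_of_poly (x_ ^+ 2 * y_)) S.
Proof.
(* The sum is T_0 / x, because A_0 = x y T_0 and the prefactor is x^2 y. *)
exists (fun n => genT 0 n.+1); split=> [n|n].
  exists n.+1 => -[//|M]; rewrite ltnS => le_nM.
  have := congr1 (fun f : fps {poly int} => f n.+1) (partial_sum M).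
  have -> : genV 0 = genT 0 by rewrite /genV /factors big_geq // mul1r.
  rewrite fpsD fpsXM fps_sum => <-; rewrite -[LHS]addr0; congr (_ + _).
  (* The remainder is a multiple of [genT M.+1], whose coefficients vanish up to degree [M.+1],
     hence it contributes nothing in degree [n.+1]. *)
  symmetry; rewrite [_ * genV _]mulrC /genV [factors _ * _]mulrC -!mulrA.
  rewrite mulrC [LHS]big1 // => i _; rewrite genT_vanish ?mulr0 //.
  by rewrite (leq_trans (leq_subr _ _)).
have XT : X * (fun n => genT 0 n.+1) = genT 0.
  by apply: fpsP => -[|k]; rewrite fpsXM //= genT_vanish.
have -> : genA 0 = fps_of_poly (x_ ^+ 2 * y_) * (fun n => genT 0 n.+1); last by [].
have A0 := genA_rec 0; rewrite mul0r subr0 mul1r -XT in A0; rewrite A0.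
by rewrite rmorphM rmorphXn /=; ring.
Qed.

(** * Summation over marked words and derangements *)

Lemma sum_count_prefix (R : nmodType) (Q : pred nat) (h : nat -> R) n :
  \sum_(p <- iota 0 n | Q p) h (count Q (iota 0 p)) =
  \sum_(c < count Q (iota 0 n)) h c.
Proof.
elim: n => [|n IHn]; first by rewrite big_nil big_ord0.
rewrite -addn1 iotaD big_cat /= IHn count_cat big_cons big_nil /= add0n addn0.
by case: (Q n); rewrite ?addn1 ?big_ord_recr ?addr0 ?addn0.
Qed.

Lemma sum_insert m o (g : state -> {poly int}) :
  (0 < m)%N -> all (ltn m) (word o) -> cycles_ok o.2 ->
  \sum_(c <- choices o) 'X ^+ size (insert m o c).2 * g (state_of (insert m o c)) =
  'X ^+ size o.2 * transfer g (state_of o).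
Proof.
move=> m0 gtm ok; set a := count (allowed (word o)) (iota 0 (size o.1)).
have lvl : level (state_of o) = a.
  by rewrite /state_of; case: ifP => // _; case: ifP.
rewrite /choices big_cat !big_map !big_filter -[(size o.1).+1]addn1 iotaD big_cat /=.
have -> : \sum_(p <- iota 0 (size o.1) | allowed (word o) p) 
    'X ^+ size o.2 * g (state_of (insert m o (p, false)))
   = 'X ^+ size o.2 * (g (state_of o) *+ a).
  rewrite -mulr_sumr; congr (_ * _).
  rewrite big_seq_cond (eq_bigr (fun=> g (state_of o))); last first.
    by move=> p /andP[]; rewrite mem_iota => /andP[_ lt_p] al; rewrite state_insert.
  by rewrite -big_seq_cond big_const_seq iter_addr_0.
have -> : \sum_(p <- iota 0 (size o.1) | allowed (word o) p) 
    'X ^+ (size o.2).+1 * g (state_of (insert m o (p, true)))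
   = 'X ^+ size o.2 * ('X * \sum_(c < a) g (StA c)).
  rewrite -mulr_sumr exprSr -mulrA; congr (_ * (_ * _)).
  (* From left to right, the number of allowed positions before the chosen one takes each value
     below [a] once. *)
  rewrite -(sum_count_prefix _ (fun c => g (StA c))) big_seq_cond [RHS]big_seq_cond.
  apply: eq_bigr => p /andP[]; rewrite mem_iota => /andP[_ lt_p] al.
  by rewrite state_insert_cycle.
rewrite big_cons big_nil /= add0n /transfer lvl !mulrDr; congr (_ + _ + _).
rewrite addr0; case: ifP => al.
  rewrite state_insert_end // /state_of al -/a.
  by case: ifP.
(* A forbidden end means state [StB]: without a cycle the end is always allowed. *)
rewrite /state_of al -/a; case: nilP => [cs0|_]; last by rewrite mulr0.
by move: al; rewrite allowed_end //; apply: sub_all gtm => x; apply: leq_trans.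
Qed.

Lemma sum_partials m k (g : state -> {poly int}) : (0 < m)%N ->
  \sum_(o <- partials m k) 'X ^+ size o.2 * g (state_of o) = weight g k.
Proof.
elim: k m g => [|k IHk] m g m0; first by rewrite big_seq1 expr0 mul1r.
rewrite partialsS big_allpairs_dep weightS -(IHk m.+1) // big_seq [RHS]big_seq.
apply: eq_bigr => o; rewrite mem_partials // => Vo.
by apply: sum_insert; [| exact: valid_gt Vo | case/and3P: Vo].
Qed.

(** Level 0 forces [o.1] to be empty, since position 0 is always allowed; that position is then the
    one just before the first cycle. *)
Lemma state_of_StA0 o :
  (if state_of o is StA b then (b == 0%N)%:R else 0 : {poly int}) =
  (nilp o.1 && ~~ nilp o.2)%:R.
Proof.
case: o => -[|a u] [|c cs] //; rewrite /state_of /=.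
by case: ifP.
Qed.

Lemma d_21_3_genA n : d_21_3 n.+1 = genA 0 n.+1.
Proof.
rewrite /genA -(@sum_partials 1) //.
under eq_bigr do rewrite state_of_StA0 mulr_natr mulrb.
rewrite -big_mkcond.
have -> : d_21_3 n.+1 =
  \sum_(cs <- [seq letters (standard_cycle_form s) | s in D_21_3 n.+1]) 'X ^+ size cs.
  rewrite big_map big_enum; apply: eq_bigr => s _.
  by rewrite mu_cycle_form [size (letters _)]size_map.
rewrite -big_filter -(big_map snd xpredT (fun cs => 'X ^+ size cs)).
apply: perm_big; apply: uniq_perm.
- rewrite map_inj_uniq ?enum_uniq //.
  by move=> s t /letters_inj/standard_cycle_form_inj.
- rewrite map_inj_in_uniq ?filter_uniq ?partials_uniq //.
  move=> [u1 cs1] [u2 cs2]; rewrite !mem_filter.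
  by move=> /andP[/andP[/nilP/= -> _] _] /andP[/andP[/nilP/= -> _] _] /= ->.
move=> cs; rewrite mem_cycle_forms; apply/idP/mapP => [V|[[u cs']]].
  exists ([::], cs); rewrite // mem_filter mem_partials // V andbT /=.
  (* A word with [n.+1] letters and empty first part has at least one cycle. *)
  by case: cs V => // /and3P[/perm_size].
rewrite mem_filter mem_partials // => /andP[/andP[/nilP /= -> _] V] ->.
exact: V.
Qed.

Theorem theorem2p7 :
  exists S : fps {poly int},
    fps_has_sum
      (fun j : nat => fps_div (fps_of_poly (U_num j)) (fps_of_poly (U_den j))) S
    /\ U =1 fps_mul (fps_of_poly (x_ ^+ 2 * y_)) S.
Proof.
have [S [S_sum ES]] := U_gen_sum; exists S; split=> // n; rewrite -ES.
case: n => [|[|n]] //; last exact: d_21_3_genA.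
(* Degree 1: from the empty word, of level 0, no cycle can be started. *)
by rewrite /genA weightS /weight /transfer /= big_ord0 mulr0 !addr0.
Qed.
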